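(* For $x,y\in\mathbb C$ let $$C(x,y)=\begin{pmatrix}1&0&0&x\\0&1&0&0\\0&y&-1&0\\0&0&0&-1\end{pmatrix}$$ and, for a periodic chain of length $L\ge1$, let $\tau_C(x,y)=\operatorname{tr}_a\big(C_{aL}(x,y)\cdots C_{a1}(x,y)\big)$ acting on $(\mathbb C^2)^{\otimes L}$. Let $J_+=\sum_{j=1}^L(-1)^j\sigma_j^+$. Then $$\tau_C(x,y)=\begin{cases}0,&L\text{ odd},\\ 2\cos\!\left(\sqrt{xy}\,J_+\right),&L\text{ even},\end{cases}$$ where the cosine series terminates because $J_+^{L+1}=0$.
   Context: Matrices on $\mathbb C^2\otimes\mathbb C^2$ are written in the ordered basis $|00\rangle,|01\rangle,|10\rangle,|11\rangle$. $C_{aj}$ denotes $C$ acting on the auxiliary copy $a$ of $\mathbb C^2$ (first tensor factor) and the $j$-th physical copy of $\mathbb C^2$ (second tensor factor), and as the identity on the other factors; $\operatorname{tr}_a$ is the partial trace over the auxiliary copy. $\sigma^+=\begin{pmatrix}0&1\\0&0\end{pmatrix}$, and $\sigma_j^+$ is $\sigma^+$ acting on the $j$-th factor of $(\mathbb C^2)^{\otimes L}$. The cosine is defined by its power series, $\cos(\sqrt{xy}\,J_+)=\sum_{n\ge0}\frac{(-xy)^n}{(2n)!}J_+^{2n}$, so it does not depend on the choice of square root. *)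

(* Defs.v *)
From HB Require Import structures.
From mathcomp Require Import all_boot all_order all_algebra.
From mathcomp Require Export mxtens complex.
From mathcomp Require Import all_classical all_reals all_analysis.
Set Implicit Arguments.
Unset Strict Implicit.
Unset Printing Implicit Defensive.
Import Order.TTheory GRing.Theory Num.Theory.
Import numFieldNormedType.Exports.

Local Open Scope ring_scope.

(* The dimension 2 ^ L of (K^2)^{⊗L}, in a form for which the dimension at L.+1
   is convertible to 2 * (the dimension at L); (2 ^ L)%N is not. *)
Definition cdim (L : nat) : nat := iter L (muln 2) 1%N.

Section SpinChain.
Variable K : comNzRingType.

(* [tens L A] is the Kronecker product A 1 ⊗ A 2 ⊗ ... ⊗ A L. *)
Fixpoint tens (L : nat) (A : nat -> 'M[K]_2) : 'M[K]_(cdim L) :=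
  match L return 'M[K]_(cdim L) with
  | 0 => 1%:M
  | L'.+1 => A 1%N *t tens L' (fun k => A k.+1)
  end.

(* Sites are numbered 1, ..., L; outside this range [site L j A] is the
   identity. *)
Definition site (L j : nat) (A : 'M[K]_2) : 'M[K]_(cdim L) :=
  tens L (fun k => if k == j then A else 1%:M).

(* The operator <a| M |b> on K^d, where M acts on K^2 ⊗ K^d. *)
Definition aux_block (d : nat) (a b : 'I_2) (M : 'M[K]_(2 * d)) : 'M[K]_d :=
  \matrix_(i < d, j < d) M (mxtens_index (a, i)) (mxtens_index (b, j)).

Definition ptrace_aux (d : nat) (M : 'M[K]_(2 * d)) : 'M[K]_d :=
  \sum_(a < 2) aux_block a a M.

(* M_{aj}: writing M = \sum_(a, b) |a><b| ⊗ M^{ab}, the second tensor factor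
   M^{ab} is placed at site j. *)
Definition aux_site (L j : nat) (M : 'M[K]_(2 * 2)) : 'M[K]_(2 * cdim L) :=
  \sum_(a < 2) \sum_(b < 2) delta_mx a b *t site L j (aux_block a b M).

(* [mxtens_index] orders the basis of K^2 ⊗ K^2 as |00>, |01>, |10>, |11>. *)
Definition Cmx (x y : K) : 'M[K]_(2 * 2) :=
  \matrix_(i < 2 * 2, j < 2 * 2)
    nth 0 (nth [::] [:: [:: 1; 0;  0;  x];
                        [:: 0; 1;  0;  0];
                        [:: 0; y; -1;  0];
                        [:: 0; 0;  0; -1]] i) j.

Definition tauC (L : nat) (x y : K) : 'M[K]_(cdim L) :=
  ptrace_aux (\prod_(j <- rev (iota 1 L)) aux_site L j (Cmx x y)).

Definition sigma_plus : 'M[K]_2 :=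
  \matrix_(i < 2, j < 2) nth 0 (nth [::] [:: [:: 0; 1]; [:: 0; 0]] i) j.

Definition Jplus (L : nat) : 'M[K]_(cdim L) :=
  \sum_(1 <= j < L.+1) (-1) ^+ j *: site L j sigma_plus.

End SpinChain.

Arguments sigma_plus {K}.
Arguments Jplus K L : clear implicits.

Section MatrixCosine.
Variable K : numFieldType.

Definition cos_sqrt_term (d : nat) (z : K) (A : 'M[K]_d) (n : nat) : 'M[K]_d :=
  ((- z) ^+ n / ((2 * n)`!)%:R) *: A ^+ (2 * n).

(* cos(√z A), the limit of the partial sums in the normed space of matrices.
   The series only involves z, so no square root is chosen. *)
Definition cos_sqrt (d : nat) (z : K) (A : 'M[K]_d) : 'M[K]_d :=
  limn (series (cos_sqrt_term z A)).

End MatrixCosine.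

(* Main.v *)
Require Import Defs.
From HB Require Import structures.
From mathcomp Require Import all_boot all_order all_algebra.
From mathcomp Require Import all_classical all_reals all_analysis.
From mathcomp Require Import zify.
Set Implicit Arguments.
Unset Strict Implicit.
Unset Printing Implicit Defensive.
Import Order.TTheory GRing.Theory Num.Theory.
Import numFieldNormedType.Exports.
Local Open Scope ring_scope.

(* On the auxiliary space C_{aj} = Z + N s_j, where Z = diag(1, -1),
   N = [[0, x], [y, 0]] anticommutes with Z, and the s_j = sigma_j^+ commute and
   square to zero.  Moving every Z to the left turns C_{am} ... C_{a1} into
   Z^m \prod_j (1 - (-1)^j ZN s_j) = Z^m exp(- ZN J_m), where
   J_m = \sum_(j <= m) (-1)^j s_j and (ZN)^2 = - xy.  Its 2 x 2 blocks over the
   auxiliary space are the even (cosine) part A_m and odd (sine) part B_m of the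
   exponential, namely [[A_m, - x B_m], [(-1)^m y B_m, (-1)^m A_m]]; the trace is
   (1 + (-1)^L) A_L.  The blocks are established by induction on m, since adding
   a commuting square-zero s to J adds s J^k / k! to J^(k+1) / (k+1)!. *)

(** * One-site operators on the chain and their auxiliary blocks *)

Section TensorProducts.
Variable K : comNzRingType.
Implicit Types (A B : nat -> 'M[K]_2) (M N : 'M[K]_2).

Lemma eq_tens L A B :
  (forall k, (0 < k)%N -> A k = B k) -> tens L A = tens L B.
Proof.
elim: L A B => [//|L IHL] A B AB /=.
by rewrite AB // (IHL _ (fun k => B k.+1)) // => k _; apply: AB.
Qed.

Lemma tensM L A B : tens L A * tens L B = tens L (fun k => A k * B k).
Proof.
elim: L A B => [|L IHL] A B /=; first by rewrite mulr1.
by rewrite -mulmxE tensmx_mul !mulmxE IHL.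
Qed.

Lemma tens1 L : tens L (fun=> 1%:M : 'M[K]_2) = 1.
Proof.
elim: L => [//|L /= ->]; apply/matrixP=> i j.
case: (mxtens_indexP i) => i1 i2; case: (mxtens_indexP j) => j1 j2.
rewrite tensmxE !mxE (can_eq (@mxtens_indexK _ _)) xpair_eqE.
by case: eqP; case: eqP; rewrite /= ?mulr1 ?mulr0.
Qed.

Lemma site1 L j : site L j 1%:M = 1 :> 'M[K]_(cdim L).
Proof. by rewrite -(tens1 L); apply: eq_tens => k _; case: ifP. Qed.

Lemma siteM L j M N : site L j M * site L j N = site L j (M * N).
Proof.
by rewrite tensM; apply: eq_tens => k _; case: ifP => // _; rewrite mulr1.
Qed.

Lemma site_comm L j k M N :
  j != k -> GRing.comm (site L j M) (site L k N).
Proof.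
move=> jk; rewrite /GRing.comm !tensM; apply: eq_tens => l _.
case: eqP => [->|_]; first by rewrite (negPf jk) mulr1 mul1r.
by rewrite mulr1 mul1r.
Qed.

Lemma siteS L j M : (0 < j)%N -> site L.+1 j.+1 M = 1%:M *t site L j M.
Proof. by case: j. Qed.

Lemma site1S L M : site L.+1 1 M = M *t 1.
Proof.
rewrite /site /= (_ : tens L _ = 1) // -(tens1 L).
(* [tens] reads only positive indices; at index 0 the shifted family takes the value [M], not the
   identity. *)
by apply: eq_tens => -[].
Qed.

Lemma tensmxZl m n p q c (A : 'M[K]_(m, n)) (B : 'M[K]_(p, q)) :
  (c *: A) *t B = c *: (A *t B).
Proof. by apply/matrixP=> i j; rewrite !mxE mulrA. Qed.

Lemma tensmxZr m n p q c (A : 'M[K]_(m, n)) (B : 'M[K]_(p, q)) :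
  A *t (c *: B) = c *: (A *t B).
Proof. by apply/matrixP=> i j; rewrite !mxE mulrCA. Qed.

(** The range condition matters: outside it [site] is the identity whatever the matrix, hence not
    linear. *)
Lemma siteZ L j c M :
  (0 < j <= L)%N -> site L j (c *: M) = c *: site L j M.
Proof.
elim: L j => [|L IHL] [|[|j]] //; first by rewrite !site1S tensmxZl.
by move=> jL; rewrite !siteS // IHL // tensmxZr.
Qed.

Lemma site0 L j : (0 < j <= L)%N -> site L j 0 = 0 :> 'M[K]_(cdim L).
Proof. by move=> jL; rewrite -(scale0r 0) siteZ // scale0r. Qed.

Lemma sigma_plus_sqr : sigma_plus * sigma_plus = 0 :> 'M[K]_2.
Proof.
apply/matrixP=> i j; rewrite !mxE big_ord_recl big_ord1 !mxE /=.
by case: i j => [[|[|//]] ?] [[|[|//]] ?] /=; rewrite ?mulr0 ?mul0r ?addr0.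
Qed.

Lemma site_sigma_plus_sqr L j : (0 < j <= L)%N ->
  site L j sigma_plus * site L j sigma_plus = 0 :> 'M[K]_(cdim L).
Proof. by move=> jL; rewrite siteM sigma_plus_sqr site0. Qed.

Lemma aux_blockM d (a b : 'I_2) (M N : 'M[K]_(2 * d)) :
  aux_block a b (M * N) = \sum_(c < 2) aux_block a c M * aux_block c b N.
Proof.
apply/matrixP=> i j; rewrite summxE !mxE.
transitivity (\sum_(c < 2) \sum_(k < d)
    M (mxtens_index (a, i)) (mxtens_index (c, k))
      * N (mxtens_index (c, k)) (mxtens_index (b, j))).
  (* [mxtens_index] is a bijection, so the sum over a basis of the tensor product splits into
     auxiliary and physical indices. *)
  rewrite pair_bigA (reindex (@mxtens_unindex 2 d)).
    apply: eq_bigr => k _.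
    by rewrite /= (mxtens_unindexK k : mxtens_index (_, _) = k).
  by exists (@mxtens_index 2 d) => ? _; rewrite ?mxtens_indexK ?mxtens_unindexK.
apply: eq_bigr => c _; rewrite mxE; apply: eq_bigr => k _.
by rewrite !mxE.
Qed.

Lemma aux_block1 d (a b : 'I_2) :
  aux_block a b (1 : 'M[K]_(2 * d)) = (a == b)%:R%:M.
Proof.
apply/matrixP=> i j; rewrite !mxE (can_eq (@mxtens_indexK _ _)) xpair_eqE.
by case: eqP => _; case: eqP => _; rewrite ?mulr1n ?mulr0n.
Qed.

Lemma aux_block_aux_site L j (a b : 'I_2) (M : 'M[K]_(2 * 2)) :
  aux_block a b (aux_site L j M) = site L j (aux_block a b M).
Proof.
apply/matrixP=> i k; rewrite mxE summxE (bigD1 a) //= summxE (bigD1 b) //=.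
rewrite tensmxE mxE !eqxx mul1r big1 ?addr0 => [|c cb]; last first.
  by rewrite tensmxE mxE eqxx eq_sym (negPf cb) mul0r.
rewrite big1 ?addr0 // => c ca; rewrite summxE big1 // => e _.
by rewrite tensmxE mxE eq_sym (negPf ca) mul0r.
Qed.

Lemma aux_block_Cmx (x y : K) :
  [/\ aux_block 0 0 (Cmx x y) = 1%:M,
      aux_block 0 1 (Cmx x y) = x *: sigma_plus,
      aux_block 1 0 (Cmx x y) = y *: sigma_plus
    & aux_block 1 1 (Cmx x y) = (-1) *: 1%:M].
Proof.
split; apply/matrixP=> -[[|[|//]] i] [[|[|//]] j]; rewrite !mxE /=;
  by rewrite ?mulr1 ?mulr0 ?mulrN1.
Qed.

End TensorProducts.

(* The algebra structure of the library requires a nonzero dimension. *)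
Section SquareMatrixScaling.
Variables (K : comNzRingType) (d : nat).
Implicit Types (c : K) (M N : 'M[K]_d).

Lemma mxscalerAl c M N : c *: (M * N) = (c *: M) * N.
Proof. exact: scalemxAl. Qed.

Lemma mxscalerAr c M N : c *: (M * N) = M * (c *: N).
Proof. exact: scalemxAr. Qed.

End SquareMatrixScaling.

(** * Divided powers and truncated trigonometric series *)

Section DividedPowers.
Variables (K : numFieldType) (d : nat).
Implicit Types (s J : 'M[K]_d) (z : K).

(** Only the first two terms of the binomial expansion survive. *)
Lemma exprD_sqr0 s J k : GRing.comm J s -> s * s = 0 ->
  (J + s) ^+ k.+1 = J ^+ k.+1 + k.+1%:R *: (s * J ^+ k).
Proof.
move=> Js ss; elim: k => [|k IHk]; first by rewrite expr0 !expr1 mulr1 scale1r.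
rewrite exprS IHk mulrDl !mulrDr -exprS -!mxscalerAr [s * (s * _)]mulrA ss.
rewrite mul0r scaler0 addr0 mulrA Js -mulrA -exprS -addrA; congr (_ + _).
by rewrite -[X in _ + X]scale1r -scalerDl natr1.
Qed.

Definition div_power J k : 'M[K]_d := (k`!%:R)^-1 *: J ^+ k.

Lemma div_power0 J : div_power J 0 = 1.
Proof. by rewrite /div_power invr1 scale1r. Qed.

Lemma div_powerD s J k : GRing.comm J s -> s * s = 0 ->
  div_power (J + s) k.+1 = div_power J k.+1 + s * div_power J k.
Proof.
move=> Js ss; rewrite /div_power exprD_sqr0 // scalerDr -mxscalerAr scalerA.
by rewrite factS natrM invfM mulrAC mulVf ?mul1r // pnatr_eq0.
Qed.

Lemma div_power_eq0 J m k : J ^+ m = 0 -> (m <= k)%N -> div_power J k = 0.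
Proof.
by move=> J0 mk; rewrite /div_power -(subnK mk) exprD J0 mulr0 scaler0.
Qed.

(** Truncations of cos(√z J) and of sin(√z J)/√z; both series involve only z. *)
Definition even_part N z J := \sum_(n < N) (- z) ^+ n *: div_power J (2 * n).
Definition odd_part N z J := \sum_(n < N) (- z) ^+ n *: div_power J (2 * n).+1.

Lemma even_partD N z s J : GRing.comm J s -> s * s = 0 ->
  J ^+ (2 * N).+1 = 0 ->
  even_part N.+1 z (J + s) = even_part N.+1 z J - z *: (s * odd_part N.+1 z J).
Proof.
move=> Js ss J0.
(* The constant term 1 does not see [s], so only [N] terms produce an odd part; the last term of
   [odd_part N.+1] is killed by nilpotency. *)
rewrite /odd_part big_ord_recr /= /even_part !(big_ord_recl N) /=.
rewrite (div_power_eq0 J0 (leqnn _)) scaler0 addr0 muln0 !div_power0 -addrA.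
congr (_ + _); rewrite mulr_sumr scaler_sumr -sumrN -big_split /=.
apply: eq_bigr => n _; rewrite mulnS div_powerD // scalerDr.
by congr (_ + _); rewrite -[bump 0 n]/(n.+1) exprS -scalerA mxscalerAr scaleNr.
Qed.

Lemma odd_partD N z s J : GRing.comm J s -> s * s = 0 ->
  odd_part N z (J + s) = odd_part N z J + s * even_part N z J.
Proof.
move=> Js ss; rewrite /even_part /odd_part mulr_sumr -big_split /=.
by apply: eq_bigr => n _; rewrite div_powerD // scalerDr mxscalerAr.
Qed.

End DividedPowers.

Section Limit.
Variables (K : numFieldType) (d : nat).

Lemma cos_sqrt_termE (z : K) (J : 'M[K]_d) n :
  cos_sqrt_term z J n = (- z) ^+ n *: div_power J (2 * n).
Proof. by rewrite /div_power scalerA. Qed.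

(** From index [N] on the partial sums are constant, and limits are unique in a Hausdorff space. *)
Lemma cos_sqrt_nilp N (z : K) (J : 'M[K]_d) :
  J ^+ (2 * N) = 0 -> cos_sqrt z J = even_part N z J.
Proof.
move=> J0; apply: lim_near_cst; first exact: norm_hausdorff.
exists N => // m /= Nm.
rewrite /series /= (big_cat_nat _ Nm) //= -[RHS]addr0; congr (_ + _).
  by rewrite big_mkord; apply: eq_bigr => n _; apply: cos_sqrt_termE.
rewrite big_nat big1 // => n /andP[Nn _].
by rewrite cos_sqrt_termE (div_power_eq0 J0) ?scaler0 // leq_mul2l.
Qed.

End Limit.

(** * Blocks of the partial monodromy *)

Section Monodromy.
Variables (K : numFieldType) (L : nat).
Local Notation s j := (site L j (@sigma_plus K)).

(** The physical space keeps all [L] sites while [m] grows, which allows induction on [m]. *)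
Definition Jpartial m : 'M[K]_(cdim L) :=
  \sum_(1 <= j < m.+1) (-1) ^+ j *: s j.

Lemma JpartialS m : Jpartial m.+1 = Jpartial m + (-1) ^+ m.+1 *: s m.+1.
Proof. by rewrite /Jpartial big_nat_recr. Qed.

Lemma Jpartial_comm m : GRing.comm (Jpartial m) ((-1) ^+ m.+1 *: s m.+1).
Proof.
rewrite /GRing.comm /Jpartial mulr_suml mulr_sumr !big_nat.
apply: eq_bigr => j /andP[_ jm].
rewrite -!mxscalerAl -!mxscalerAr !scalerA mulrC site_comm //.
by rewrite neq_ltn jm.
Qed.

Lemma site_term_sqr m : (m < L)%N ->
  ((-1) ^+ m.+1 *: s m.+1) * ((-1) ^+ m.+1 *: s m.+1) = 0.
Proof.
by move=> mL; rewrite -mxscalerAl -mxscalerAr site_sigma_plus_sqr ?scaler0.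
Qed.

(** Each added square-zero term raises the nilpotency order by at most one. *)
Lemma Jpartial_nilp m : (m <= L)%N -> Jpartial m ^+ m.+1 = 0.
Proof.
elim: m => [|m IHm] mL; first by rewrite expr1 /Jpartial big_nil.
rewrite JpartialS exprD_sqr0; [|exact: Jpartial_comm|exact: site_term_sqr].
by rewrite exprS (IHm (ltnW mL)) !mulr0 scaler0 addr0.
Qed.

Lemma Jpartial_expr_eq0 m k : (m <= L)%N -> (m < k)%N -> Jpartial m ^+ k = 0.
Proof.
by move=> mL mk; rewrite -(subnK mk) exprD Jpartial_nilp // mulr0.
Qed.

Variables x y : K.
Local Notation z := (x * y).

Definition monodromy m : 'M[K]_(2 * cdim L) :=
  \prod_(j <- rev (iota 1 m)) aux_site L j (Cmx x y).

Lemma monodromyS m :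
  monodromy m.+1 = aux_site L m.+1 (Cmx x y) * monodromy m.
Proof. by rewrite /monodromy -[X in iota _ X]addn1 iotaD rev_cat big_cons add1n. Qed.

(** One truncation order serves every [m <= L], since the power 2L+1 of [Jpartial m] vanishes. *)
Let A m := even_part L.+1 z (Jpartial m).
Let B m := odd_part L.+1 z (Jpartial m).

Lemma monodromy_block m : (m <= L)%N ->
  [/\ aux_block 0 0 (monodromy m) = A m,
      aux_block 0 1 (monodromy m) = - x *: B m,
      aux_block 1 0 (monodromy m) = ((-1) ^+ m * y) *: B m
    & aux_block 1 1 (monodromy m) = (-1) ^+ m *: A m].
Proof.
elim: m => [|m IHm] mL.
  have J0 : Jpartial 0 = 0 by rewrite /Jpartial big_nil.
  have A0 : A 0%N = 1.
    rewrite /A /even_part J0 big_ord_recl big1 ?addr0 => [|i _].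
      by rewrite /div_power muln0 !expr0 fact0 invr1 !scale1r.
    by rewrite (@div_power_eq0 _ _ _ 1) ?scaler0 ?expr1.
  have B0 : B 0%N = 0.
    rewrite /B /odd_part J0 big1 // => i _.
    by rewrite (@div_power_eq0 _ _ _ 1) ?scaler0 ?expr1.
  rewrite /monodromy big_nil !aux_block1 A0 B0 !scaler0 /= expr0 scale1r.
  by split=> //; apply/matrixP=> i j; rewrite !mxE mul0rn.
have [T00 T01 T10 T11] := IHm (ltnW mL).
have [C00 C01 C10 C11] := aux_block_Cmx x y.
have Js := Jpartial_comm m; have ss := site_term_sqr mL.
have AS : A m.+1 = A m + ((-1) ^+ m * z) *: (s m.+1 * B m).
  rewrite /A JpartialS even_partD //; last first.
    by apply: Jpartial_expr_eq0; [exact: ltnW|lia].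
  by rewrite -mxscalerAl scalerA -scaleNr exprS mulN1r mulrN opprK [z * _]mulrC.
have BS : B m.+1 = B m - (-1) ^+ m *: (s m.+1 * A m).
  by rewrite /B JpartialS odd_partD // -mxscalerAl exprS mulN1r scaleNr.
have signm : (-1) ^+ m * (-1) ^+ m = 1 :> K by rewrite -expr2 sqrr_sign.
(* The new factor has blocks [[1, x s], [y s, -1]] with s at site m+1; the product of blocks
   reproduces [AS] and [BS] up to signs. *)
rewrite monodromyS !aux_blockM !big_ord_recl !big_ord0 !addr0.
rewrite (_ : lift ord0 ord0 = 1); last exact: val_inj.
rewrite !aux_block_aux_site C00 C01 C10 C11.
rewrite !siteZ // !site1 T00 T01 T10 T11 !mul1r AS BS.
rewrite -!mxscalerAl -!mxscalerAr !mul1r !scalerDr !scalerN !scalerA exprS.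
split; rewrite ?mulN1r ?mulNr ?scaleNr ?opprK //.
- by rewrite mulrCA.
- by rewrite mulrAC signm mul1r addrC.
- by rewrite mulrA signm mul1r mulrN [y * x]mulrC scaleNr addrC.
Qed.

End Monodromy.

Theorem proposition4 (R : realType) (x y : R[i]) (L : nat) (hL : (1 <= L)%N) :
  [/\ tauC L x y =
        if odd L then 0 else 2 *: cos_sqrt (x * y) (Jplus R[i] L),
      Jplus R[i] L ^+ L.+1 = 0
    & forall n : nat, (L < 2 * n)%N ->
        cos_sqrt_term (x * y) (Jplus R[i] L) n = 0].
Proof.
have J0 k : (L < k)%N -> Jplus R[i] L ^+ k = 0.
  (* [Jplus] is [Jpartial] at m = L by conversion. *)
  exact: Jpartial_expr_eq0.
split; [|exact: J0|by move=> n /J0 Jn; rewrite /cos_sqrt_term Jn scaler0].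
(* The truncation order L+1 is the one used in [monodromy_block]. *)
rewrite (@cos_sqrt_nilp _ _ L.+1); last by apply: J0; lia.
have [T00 _ _ T11] := monodromy_block x y (leqnn L).
rewrite /tauC /ptrace_aux big_ord_recl big_ord1.
rewrite (_ : lift ord0 ord0 = 1); last exact: val_inj.
rewrite T00 T11 -signr_odd; case: (odd L).
  by rewrite expr1 scaleN1r subrr.
by rewrite expr0 -{1}[even_part _ _ _]scale1r -scalerDl.
Qed.
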